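(* Let $X^{*} \in \{0,1\}^{n}$ be the baseline tactical plan of the log-truck routing and scheduling problem described in the context, let $e$ be a disruption event, and let $\mathcal{F}(e)$ be the disrupted feasible region of the corresponding reoptimization model, as defined in the context. Define the minimal feasible deviation $$k_{\min} \;=\; \min_{X \in \mathcal{F}(e)} \lVert X - X^{*} \rVert_1 ,$$ and consider the mixed-integer programme $$ \begin{aligned} (\mathrm{M}) \qquad \min_{X,\,\delta^{+},\,\delta^{-}} \quad & \sum_{i=1}^{n} \bigl(\delta^{+}_{i} + \delta^{-}_{i}\bigr) \\ \text{s.t.}\quad & \delta^{+}_{i} \geq X_{i} - X^{*}_{i}, \qquad i=1,\dots,n,\\ & \delta^{-}_{i} \geq X^{*}_{i} - X_{i}, \qquad i=1,\dots,n,\\ & X \in \mathcal{F}(e), \\ & X \in \{0,1\}^{n}, \quad \delta^{+}, \delta^{-} \in \{0,1\}^{n}. \end{aligned} $$ Let $(X, \delta^{+}, \delta^{-})$ be an optimal solution of $(\mathrm{M})$. Then $\delta^{+}_{i} + \delta^{-}_{i} = |X_{i} - X^{*}_{i}|$ for every $i$, and the optimal value of $(\mathrm{M})$ equals $k_{\min}$. Moreover, the associated plan $X$ attains the minimum defining $k_{\min}$, so it is a most stable feasible recovery plan.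
   Context: **Network and plans.** $F$ is the set of forest sites, $M$ of mills, $V$ of trucks, $P$ of wood products, $I$ of time intervals, $T$ of days; $\mathcal{L}$ is the set of locations (mills, forest sites, home bases). $N$ is the set of space-time nodes $(\ell,i)$, $\ell\in\mathcal{L}$, $i\in I$; $A$ is the set of arcs joining such nodes; $A^{+}(\cdot)$ and $A^{-}(\cdot)$ are the sets of arcs leaving and entering a node; $\mathcal{HB}_v$ is the set of home bases eligible for truck $v$. $A_f^{mp}$ is the set of loaded arcs from site $f$ to mill $m$ for product $p$; $A_{fi}^{L}$ and $A_{mi}^{U}$ are the loading arcs at site $f$ and unloading arcs at mill $m$ in interval $i$. A plan is a binary vector $X=(x_{avt})_{a\in A,v\in V,t\in T}$, with $x_{avt}=1$ if truck $v$ uses arc $a$ on day $t$; its coordinates are also indexed $X_1,\dots,X_n$. $X^{*}$ is the plan in place before the event. **Parameters.** $q_v$ is the payload of truck $v$, $K_v$ its maximum number of loaded trips per day, $\beta_v\in\{0,1\}$ equals 1 if it lacks self-loading capability; $d_{mp}$ is the demand of mill $m$ for product $p$; $s_{fp}$ the supply of $p$ at site $f$; $\Lambda_{fi},\Lambda_{mi}$ the loader capacities in interval $i$; $i_a^{+}$ the start time of the interval of the head node of arc $a$; $S_a$ the service duration on $a$; $[\tau_a^{o},\tau_a^{c}]$ the operating window at the head location of $a$; $B$ a sufficiently large constant. **Event.** A disruption event $e$ (road or site closure, delay, breakdown, demand or supply variation, ...) occurs at time $\tau_e$ and induces a set of arc removals $\Delta\mathcal{A}(e)$ and parameter changes $\Delta\theta(e)$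 (for example of demand, supply, capacities). **Disrupted feasible region.** $\mathcal{F}(e)$ is the set of plans $X\in\{0,1\}^n$ satisfying the complete constraint set of the reoptimization model, that is, the following constraints with all parameters at their values after the change $\Delta\theta(e)$, where $u_{mp}\in\{0,\dots,d_{mp}\}$ is the unmet demand: - fleet: $\sum_{a\in A^{+}(h)}x_{avt}\le 1$ and $\sum_{a\in A^{-}(h)}x_{avt}=\sum_{a\in A^{+}(h)}x_{avt}$ for all $v\in V$, $h\in\mathcal{HB}_v$, $t\in T$; - flow conservation: $\sum_{a\in A^{+}(\nu)}x_{avt}=\sum_{a\in A^{-}(\nu)}x_{avt}$ for all $v\in V$, $\nu\in N$, $t\in T$; - demand: $\sum_{t\in T}\sum_{f\in F}\sum_{v\in V}\sum_{a\in A_f^{mp}}q_v x_{avt}+u_{mp}=d_{mp}$ for all $m\in M$, $p\in P$; - supply: $\sum_{t\in T}\sum_{m\in M}\sum_{v\in V}\sum_{a\in A_f^{mp}}q_v x_{avt}\le s_{fp}$ for all $f\in F$, $p\in P$; - trips: $\sum_{m\in M}\sum_{f\in F}\sum_{p\in P}\sum_{a\in A_f^{mp}}x_{avt}\le K_v$ for all $v\in V$, $t\in T$; - loaders: $\sum_{v\in V}\sum_{a\in A_{fi}^{L}}\beta_v x_{avt}\le\Lambda_{fi}$ for all $i\in I$, $f\in F$, $t\in T$, and $\sum_{v\in V}\sum_{a\in A_{mi}^{U}}\beta_v x_{avt}\le\Lambda_{mi}$ for all $i\in I$, $m\in M$, $t\in T$; - time windows: $i_a^{+}-B(1-x_{avt})+S_a\le\tau_a^{c}$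 and $\tau_a^{o}\le i_a^{+}+B(1-x_{avt})$ for all $v\in V$, $a\in A$, $t\in T$; - arc removals: arcs in $\Delta\mathcal{A}(e)$ are not used while removed; - fixing: $x_{avt}=x^{*}_{avt}$ for every decision $(a,v,t)$ completed before $\tau_e$. $\lVert X-X^{*}\rVert_1=\sum_{i=1}^n|X_i-X^{*}_i|$, which for binary vectors is the Hamming distance. A most stable feasible recovery plan is an element of $\mathcal{F}(e)$ minimising this distance. *)

(* Defs.v *)
From mathcomp Require Import all_boot all_order all_algebra.

Set Implicit Arguments.
Unset Strict Implicit.
Unset Printing Implicit Defensive.

Import Order.TTheory GRing.Theory Num.Theory.
Local Open Scope ring_scope.

(* Arcs form a type of their own, so that parallel arcs (e.g. for different
   products) are allowed. [completion a v t] is the absolute time at which the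
   decision (a, v, t) is completed; it is compared with the event time only. *)
Record network (R : realFieldType) := Network {
  site : finType;
  mill : finType;
  home : finType;
  truck : finType;
  product : finType;
  interval : finType;
  day : finType;
  arc : finType;
  arc_tail : arc -> (mill + site + home) * interval;
  arc_head : arc -> (mill + site + home) * interval;
  eligible : truck -> {set home};
  loaded : site -> mill -> product -> {set arc};
  loading : site -> interval -> {set arc};
  unloading : mill -> interval -> {set arc};
  completion : arc -> truck -> day -> R;
  loaded_ends : forall f m p a, a \in loaded f m p ->
    (arc_tail a).1 = inl (inr f) /\ (arc_head a).1 = inl (inl m);
  loading_at : forall f i a, a \in loading f i ->
    (arc_tail a).1 = inl (inr f) \/ (arc_head a).1 = inl (inr f);
  unloading_at : forall m i a, a \in unloading m i ->
    (arc_tail a).1 = inl (inl m) \/ (arc_head a).1 = inl (inl m)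
}.

Section Model.
Variables (R : realFieldType) (N : network R).

Definition location : finType := (mill N + site N + home N)%type.
Definition node : finType := (location * interval N)%type.

Definition home_loc (h : home N) : location := inr h.

Definition out_arcs (nu : node) : {set arc N} := [set a | arc_tail a == nu].
Definition in_arcs (nu : node) : {set arc N} := [set a | arc_head a == nu].

(* For a home base, which is a location rather than a node, A^+ and A^- collect
   the arcs leaving and entering its nodes over all intervals. *)
Definition home_out (h : home N) : {set arc N} :=
  \bigcup_(i : interval N) out_arcs (home_loc h, i).
Definition home_in (h : home N) : {set arc N} :=
  \bigcup_(i : interval N) in_arcs (home_loc h, i).

Record params := Params {
  payload : truck N -> R;                     (* q_v *)
  max_trips : truck N -> nat;                 (* K_v *)
  needs_loader : truck N -> bool;             (* beta_v *)
  demand : mill N -> product N -> nat;        (* d_mp *)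
  supply : site N -> product N -> R;          (* s_fp *)
  site_cap : site N -> interval N -> R;       (* Lambda_fi *)
  mill_cap : mill N -> interval N -> R;       (* Lambda_mi *)
  start : interval N -> R;
  service : arc N -> R;                       (* S_a *)
  opening : location -> R;
  closing : location -> R
}.

(* i_a^+, tau_a^o and tau_a^c *)
Definition head_start (th : params) (a : arc N) : R := start th (arc_head a).2.
Definition arc_open (th : params) (a : arc N) : R := opening th (arc_head a).1.
Definition arc_close (th : params) (a : arc N) : R := closing th (arc_head a).1.

(* An arc fixes the time of day, so the period during which it is removed is a
   set of days. *)
Record event := Event {
  event_time : R;
  removed : {set arc N};
  removal_days : arc N -> {set day N};
  param_change : params -> params
}.

(* The triples (a, v, t) play the role of the coordinates 1, ..., n. *)
Definition decision : finType := (arc N * truck N * day N)%type.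
Definition binvec := {ffun decision -> bool}.

Definition var (X : binvec) (a : arc N) (v : truck N) (t : day N) : R :=
  (X (a, v, t))%:R.

(* The big-M constant is sufficiently large when both time-window constraints
   are void for unused arcs. *)
Definition big_enough (th : params) (B : R) : Prop :=
  forall a : arc N, head_start th a - B + service th a <= arc_close th a /\
                    arc_open th a <= head_start th a + B.

Record satisfies (th : params) (B : R) (e : event) (Xs : binvec)
    (u : mill N -> product N -> nat) (X : binvec) : Prop := Satisfies {
  fleet_once : forall (v : truck N) (h : home N) (t : day N),
    h \in eligible v -> \sum_(a in home_out h) var X a v t <= 1;
  fleet_return : forall (v : truck N) (h : home N) (t : day N),
    h \in eligible v ->
    \sum_(a in home_in h) var X a v t = \sum_(a in home_out h) var X a v t;
  flow : forall (v : truck N) (nu : node) (t : day N),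
    \sum_(a in out_arcs nu) var X a v t = \sum_(a in in_arcs nu) var X a v t;
  unmet_bound : forall (m : mill N) (p : product N), (u m p <= demand th m p)%N;
  demand_met : forall (m : mill N) (p : product N),
    \sum_(t : day N) \sum_(f : site N) \sum_(v : truck N)
      \sum_(a in loaded f m p) payload th v * var X a v t + (u m p)%:R
    = (demand th m p)%:R;
  supply_met : forall (f : site N) (p : product N),
    \sum_(t : day N) \sum_(m : mill N) \sum_(v : truck N)
      \sum_(a in loaded f m p) payload th v * var X a v t <= supply th f p;
  trips : forall (v : truck N) (t : day N),
    \sum_(m : mill N) \sum_(f : site N) \sum_(p : product N)
      \sum_(a in loaded f m p) var X a v t <= (max_trips th v)%:R;
  site_loaders : forall (i : interval N) (f : site N) (t : day N),
    \sum_(v : truck N) \sum_(a in loading f i)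
      (needs_loader th v)%:R * var X a v t <= site_cap th f i;
  mill_loaders : forall (i : interval N) (m : mill N) (t : day N),
    \sum_(v : truck N) \sum_(a in unloading m i)
      (needs_loader th v)%:R * var X a v t <= mill_cap th m i;
  window_close : forall (v : truck N) (a : arc N) (t : day N),
    head_start th a - B * (1 - var X a v t) + service th a <= arc_close th a;
  window_open : forall (v : truck N) (a : arc N) (t : day N),
    arc_open th a <= head_start th a + B * (1 - var X a v t);
  arc_removal : forall (a : arc N) (v : truck N) (t : day N),
    a \in removed e -> t \in removal_days e a -> var X a v t = 0;
  fixing : forall (a : arc N) (v : truck N) (t : day N),
    completion a v t < event_time e -> var X a v t = var Xs a v t
}.

(* F(e): [th] holds the parameters before the event. *)
Definition feasible (th : params) (B : R) (e : event) (Xs X : binvec) : Prop :=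
  exists u : mill N -> product N -> nat,
    satisfies (param_change e th) B e Xs u X.

Definition dist1 (X Y : binvec) : R :=
  \sum_(i : decision) `|(X i)%:R - (Y i)%:R|.

Definition is_minimizer (S : Type) (C : S -> Prop) (f : S -> R) (x : S) : Prop :=
  C x /\ forall y, C y -> f x <= f y.

Definition is_min_value (S : Type) (C : S -> Prop) (f : S -> R) (k : R) : Prop :=
  (exists2 x, C x & f x = k) /\ forall y, C y -> k <= f y.

Definition most_stable (th : params) (B : R) (e : event) (Xs X : binvec) : Prop :=
  is_minimizer (feasible th B e Xs) (fun Y => dist1 Y Xs) X.

Definition is_kmin (th : params) (B : R) (e : event) (Xs : binvec) (k : R) : Prop :=
  is_min_value (feasible th B e Xs) (fun Y => dist1 Y Xs) k.

(* The programme (M) in the variables (X, delta^+, delta^-). *)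
Definition mip_feasible (th : params) (B : R) (e : event) (Xs : binvec)
    (z : binvec * binvec * binvec) : Prop :=
  let: (X, dp, dm) := z in
  [/\ forall i : decision, (X i)%:R - (Xs i)%:R <= (dp i)%:R :> R,
      forall i : decision, (Xs i)%:R - (X i)%:R <= (dm i)%:R :> R &
      feasible th B e Xs X].

Definition mip_obj (z : binvec * binvec * binvec) : R :=
  let: (X, dp, dm) := z in \sum_(i : decision) ((dp i)%:R + (dm i)%:R).

Definition mip_optimal (th : params) (B : R) (e : event) (Xs : binvec)
    (z : binvec * binvec * binvec) : Prop :=
  is_minimizer (mip_feasible th B e Xs) mip_obj z.

Definition mip_value (th : params) (B : R) (e : event) (Xs : binvec) (k : R) : Prop :=
  is_min_value (mip_feasible th B e Xs) mip_obj k.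

End Model.

(* Main.v *)
Require Import Defs.
From mathcomp Require Import all_boot all_order all_algebra.
Import Order.TTheory GRing.Theory Num.Theory.
Local Open Scope ring_scope.

(** Every feasible triple (X, d+, d-) has d+ + d- >= |X - X*| coordinatewise, and
    for a fixed feasible X equality is achieved by the positive and negative
    parts of X - X*, which are binary.  Projecting onto X thus turns (M) into the
    minimisation of the distance, and the slack at an optimum is a sum of
    nonnegative terms that vanishes. *)

(** Exchanging the two plans gives the negative part, so one definition serves both deviations. *)
Definition pos_part (R : realFieldType) (N : network R) (Xs X : binvec N) :
    binvec N :=
  [ffun i => X i && ~~ Xs i].

(** Each of [x] and [- x] is bounded by one of the two bits; adding the other bit, which is
    nonnegative, keeps the bound. *)
Lemma norm_le_deviations (R : realFieldType) (x : R) (b c : bool) :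
  x <= b%:R -> - x <= c%:R -> `|x| <= b%:R + c%:R.
Proof.
move=> xb xc; rewrite ler_norml lerNl.
by rewrite (le_trans xc) ?lerDr ?ler0n // (le_trans xb) // lerDl ler0n.
Qed.

Section Projection.
Variables (R : realFieldType) (N : network R) (th : params N) (B : R).
Variables (e : event N) (Xs : binvec N).

Lemma mip_feasible_norm_le (X dp dm : binvec N) (i : decision N) :
  mip_feasible th B e Xs (X, dp, dm) ->
  `|(X i)%:R - (Xs i)%:R| <= (dp i)%:R + (dm i)%:R :> R.
Proof. by case=> hp hm _; apply: norm_le_deviations; rewrite ?opprB. Qed.

Lemma dist1_le_mip_obj (X dp dm : binvec N) :
  mip_feasible th B e Xs (X, dp, dm) -> dist1 X Xs <= mip_obj (X, dp, dm).
Proof. by move=> hz; apply: ler_sum => i _; apply: mip_feasible_norm_le. Qed.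

Lemma mip_feasible_parts (X : binvec N) :
  feasible th B e Xs X ->
  mip_feasible th B e Xs (X, pos_part _ _ Xs X, pos_part _ _ X Xs).
Proof.
by split=> // i; rewrite ffunE; case: (X i); case: (Xs i);
  rewrite ?subrr ?subr0 ?sub0r ?oppr_le0 ?ler01.
Qed.

Lemma mip_obj_parts (X : binvec N) :
  mip_obj (X, pos_part _ _ Xs X, pos_part _ _ X Xs) = dist1 X Xs.
Proof.
apply: eq_bigr => i _; rewrite !ffunE; case: (X i); case: (Xs i) => /=;
  by rewrite ?subrr ?subr0 ?sub0r ?normrN ?normr0 ?normr1 ?addr0 ?add0r.
Qed.

Lemma mip_optimal_obj (X dp dm : binvec N) :
  mip_optimal th B e Xs (X, dp, dm) -> mip_obj (X, dp, dm) = dist1 X Xs.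
Proof.
case=> hz opt; apply/eqP; rewrite eq_le dist1_le_mip_obj // andbT.
(* Keeping [X] but replacing the deviations by the two parts of [X - Xs] gives a competitor of cost
   [dist1 X Xs]. *)
by rewrite -mip_obj_parts; apply/opt/mip_feasible_parts; case: hz.
Qed.

Lemma mip_optimal_deviations (X dp dm : binvec N) (i : decision N) :
  mip_optimal th B e Xs (X, dp, dm) ->
  (dp i)%:R + (dm i)%:R = `|(X i)%:R - (Xs i)%:R| :> R.
Proof.
move=> hopt; have [hz _] := hopt; apply/eqP; rewrite -subr_eq0; apply/eqP.
pose slack j : R := (dp j)%:R + (dm j)%:R - `|(X j)%:R - (Xs j)%:R|.
apply: (@psumr_eq0P _ _ xpredT slack) => // [j _|].
  by rewrite subr_ge0; apply: mip_feasible_norm_le.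
(* The total slack is the objective minus the distance, which agree at an optimum. *)
by rewrite sumrB; apply/eqP; rewrite subr_eq0; apply/eqP/mip_optimal_obj.
Qed.

(** Any feasible [Y] lifts to a triple whose cost is its distance to [Xs], so a closer plan would
    beat the optimum. *)
Lemma mip_optimal_most_stable (X dp dm : binvec N) :
  mip_optimal th B e Xs (X, dp, dm) -> most_stable th B e Xs X.
Proof.
move=> hopt; have [[_ _ hX] opt] := hopt; split=> // Y hY.
by rewrite -(mip_optimal_obj _ _ _ hopt) -mip_obj_parts; apply/opt/mip_feasible_parts.
Qed.

End Projection.

Theorem proposition1 (R : realFieldType) (N : network R) (th : params N) (B : R)
    (e : event N) (Xs X dp dm : binvec N)
    (hB : big_enough (param_change e th) B)
    (hopt : mip_optimal th B e Xs (X, dp, dm)) :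
  (forall i : decision N,
     (dp i)%:R + (dm i)%:R = `|(X i)%:R - (Xs i)%:R| :> R) /\
  (exists k : R,
     [/\ is_kmin th B e Xs k,
         mip_value th B e Xs k,
         dist1 X Xs = k &
         most_stable th B e Xs X]).
Proof.
split=> [i|]; first exact: mip_optimal_deviations hopt.
have stableX := mip_optimal_most_stable _ _ _ _ _ _ _ _ _ hopt.
have objX := mip_optimal_obj _ _ _ _ _ _ _ _ _ hopt.
(* Both minima are attained at the given optimum: at [X] for the distance, at the whole triple for
   the programme. *)
exists (dist1 X Xs); split=> //.
  by have [hX minX] := stableX; split=> //; exists X.
by have [hz opt] := hopt; split=> [|z /opt]; [exists (X, dp, dm)|rewrite objX].
Qed.
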